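(* Let $\Gamma$ be a gain operator on $\ell^\infty_+(\mathcal I)$ with $|\mathcal I|<\infty$. The following are equivalent: (a) there exists $\rho\in\mathcal K_\infty$ such that $\Gamma_\rho$ satisfies the $\oplus$-MBI property; (b) there exists a path of strict decay for $\Gamma$.
   Context: Let $\mathcal I$ be a nonempty countable index set; $\ell^\infty_+(\mathcal I)$ is the cone of nonnegative real families $s=(s_i)_{i\in\mathcal I}$ with $\|s\|:=\sup_i|s_i|<\infty$, ordered componentwise; $\mathbf 1$ is the all-ones vector; $\oplus$ is the componentwise maximum. $\mathcal K_\infty$: continuous strictly increasing unbounded $\gamma:\mathbb R_+\to\mathbb R_+$ with $\gamma(0)=0$, acting componentwise. For $\mathcal J\subset\mathcal I$, $s_{|\mathcal J}$ agrees with $s$ on $\mathcal J$ and is $0$ elsewhere. Gain operator: for each $i$ a finite (possibly empty) $\mathcal I_i\subset\mathcal I\setminus\{i\}$; directed graph $\mathcal G$ with vertices $\mathcal I$ and edges $ji$, $j\in\mathcal I_i$; a pointwise equicontinuous family $\gamma_{ij}\in\mathcal K_\infty$ ($ji\in E(\mathcal G)$); functions $\mu_i:\ell^\infty_+(\mathcal I)\to[0,\infty]$ with (M1) some $\xi\in\mathcal K_\infty$ has $\mu_i(0)=0$, $\mu_i(s)\ge\xi(\|s\|)$; (M2) $\mu_i$ monotone; (M3) for each finite $\mathcal J$, $\mu_i$ restricted to vectors vanishing off $\mathcal J$ is finite-valued and continuous; (M4) for each norm-bounded $A$ and $\varepsilon>0$ there is $\delta>0$ with $\sup_i|\mu_i(s_{|\mathcal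 I_i})-\mu_i(s^0_{|\mathcal I_i})|\le\varepsilon$ whenever $s^0\in A$, $\|s-s^0\|\le\delta$. $\Gamma_i(s):=\mu_i([\gamma_{ij}(s_j)]_{j\in\mathcal I_i})$ (argument zero outside $\mathcal I_i$). $\Gamma_\rho:=(\mathrm{id}+\rho)\circ\Gamma$. A monotone $T$ has the $\oplus$-MBI property if there is $\varphi\in\mathcal K_\infty$ such that for all $s,b$, $s\le b\oplus T(s)$ implies $\|s\|\le\varphi(\|b\|)$. A path of strict decay for $\Gamma$ is a map $\sigma:\mathbb R_+\to\ell^\infty_+(\mathcal I)$ such that: (i) for some $\rho\in\mathcal K_\infty$, $\Gamma_\rho(\sigma(r))\le\sigma(r)$ for all $r\ge0$; (ii) $\varphi_{\min}(r)\mathbf 1\le\sigma(r)\le\varphi_{\max}(r)\mathbf 1$ for some $\varphi_{\min},\varphi_{\max}\in\mathcal K_\infty$; (iii) each $\sigma_i\in\mathcal K_\infty$; (iv) for each compact $K\subset(0,\infty)$ there are $0<l\le L$ with $l|r_1-r_2|\le|\sigma_i^{-1}(r_1)-\sigma_i^{-1}(r_2)|\le L|r_1-r_2|$ for all $r_1,r_2\in K$, $i\in\mathcal I$. *)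

(* Defs.v *)
From HB Require Import structures.
From mathcomp Require Import all_boot all_order all_algebra.
From mathcomp Require Import all_classical all_reals all_analysis.
Set Implicit Arguments. Unset Strict Implicit. Unset Printing Implicit Defensive.
Import Order.TTheory GRing.Theory Num.Theory.
Import numFieldNormedType.Exports.
Local Open Scope classical_set_scope.
Local Open Scope ring_scope.

Section GainDefs.
Variables (R : realType) (I : finType).

Definition nonneg (s : I -> R) : Prop := forall i, 0 <= s i.

Definition nrm (s : I -> R) : R := \big[Num.max/0]_(i : I) `|s i|.

Definition vle (s t : I -> R) : Prop := forall i, s i <= t i.
Definition vmax (s t : I -> R) : I -> R := fun i => Num.max (s i) (t i).
Definition ones : I -> R := fun _ => 1.

Definition restr (J : {set I}) (s : I -> R) : I -> R :=
  fun j => if j \in J then s j else 0.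

Definition vanish_off (J : {set I}) (s : I -> R) : Prop :=
  forall j, j \notin J -> s j = 0.

End GainDefs.

(* class K_infinity, for functions R_+ -> R_+ (represented as R -> R) *)
Definition Kinf (R : realType) (g : R -> R) : Prop :=
  g 0 = 0 /\
  (forall r, 0 <= r -> 0 <= g r) /\
  {within [set x : R | 0 <= x], continuous g} /\
  (forall r1 r2, 0 <= r1 -> r1 < r2 -> g r1 < g r2) /\
  (forall M : R, exists r, 0 <= r /\ M <= g r).

Definition Kinv (R : realType) (g : R -> R) (y : R) : R :=
  xget 0 [set x : R | 0 <= x /\ g x = y].

Section Gain.
Variables (R : realType) (I : finType).
Variables (Ii : I -> {set I}) (gam : I -> I -> R -> R)
          (mu : I -> (I -> R) -> \bar R).

Definition gvec (s : I -> R) (i : I) : I -> R :=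
  fun j => if j \in Ii i then gam i j (s j) else 0.

(* Gamma_i(s) = mu_i([gamma_ij(s_j)]_{j in I_i}) ; finite by (M3) *)
Definition Gamma (s : I -> R) : I -> R := fun i => fine (mu i (gvec s i)).

Definition Gamma_rho (rho : R -> R) (s : I -> R) : I -> R :=
  fun i => Gamma s i + rho (Gamma s i).

Definition is_gain_operator : Prop :=
  (forall i, i \notin Ii i) /\
  (forall i j, j \in Ii i -> Kinf (gam i j)) /\
  (forall r : R, 0 <= r -> forall eps : R, 0 < eps -> exists delta : R, 0 < delta /\
     forall i j, j \in Ii i -> forall r' : R, 0 <= r' -> `|r - r'| < delta ->
       `|gam i j r - gam i j r'| < eps) /\
  (forall i s, nonneg s -> (0 <= mu i s)%E) /\
  (exists xi : R -> R, Kinf xi /\ forall i,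
      mu i (fun _ => 0) = 0%E /\
      forall s, nonneg s -> ((xi (nrm s))%:E <= mu i s)%E) /\
  (forall i s t, nonneg s -> nonneg t -> vle s t -> (mu i s <= mu i t)%E) /\
  (forall i (J : {set I}),
     (forall s, nonneg s -> vanish_off J s -> mu i s \is a fin_num) /\
     (forall s, nonneg s -> vanish_off J s ->
        forall eps : R, 0 < eps -> exists delta : R, 0 < delta /\
          forall t, nonneg t -> vanish_off J t -> nrm (fun k => t k - s k) < delta ->
            `|fine (mu i t) - fine (mu i s)| < eps)) /\
  (forall (A : set (I -> R)), (forall s, A s -> nonneg s) ->
     (exists M : R, forall s, A s -> nrm s <= M) ->
     forall eps : R, 0 < eps -> exists delta : R, 0 < delta /\
       forall s s0, nonneg s -> A s0 -> nrm (fun k => s k - s0 k) <= delta ->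
         forall i, (`| mu i (restr (Ii i) s) - mu i (restr (Ii i) s0) | <= eps%:E)%E).

End Gain.

Definition oplus_MBI (R : realType) (I : finType) (T : (I -> R) -> I -> R) : Prop :=
  exists phi : R -> R, Kinf phi /\
    forall s b : I -> R, nonneg s -> nonneg b ->
      vle s (vmax b (T s)) -> nrm s <= phi (nrm b).

Definition path_of_strict_decay (R : realType) (I : finType)
    (Ii : I -> {set I}) (gam : I -> I -> R -> R) (mu : I -> (I -> R) -> \bar R)
    (sigma : R -> I -> R) : Prop :=
  (exists rho : R -> R, Kinf rho /\
     forall r : R, 0 <= r -> vle (Gamma_rho Ii gam mu rho (sigma r)) (sigma r)) /\
  (exists phimin phimax : R -> R, Kinf phimin /\ Kinf phimax /\
     forall r : R, 0 <= r -> forall i, phimin r * @ones R I i <= sigma r i /\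
                                     sigma r i <= phimax r * @ones R I i) /\
  (forall i, Kinf (fun r => sigma r i)) /\
  (forall K : set R, compact K -> K `<=` [set x : R | 0 < x] ->
     exists l L : R, 0 < l /\ l <= L /\
       forall r1 r2, K r1 -> K r2 -> forall i,
         l * `|r1 - r2| <= `|Kinv (fun r => sigma r i) r1 - Kinv (fun r => sigma r i) r2| /\
         `|Kinv (fun r => sigma r i) r1 - Kinv (fun r => sigma r i) r2| <= L * `|r1 - r2|).

(* Main.v *)
(* (b) => (a): if s <= b (+) Gamma_{rho/2}(s), take the least r with s <= sigma(r);
   some component k has s_k = sigma_k(r), and strict decay along sigma rules out
   s_k <= Gamma_{rho/2}(s)_k unless s = 0, so phi_min(r) <= ||b||.

   (a) => (b): let F := Gamma_rho (+) kappa(||.||) 1 with kappa so small that F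
   is still MBI. There are decaying points (F(s) <= s) above every N 1. From each
   of them descend by D(s) := F(s) (+) s/2; MBI forces the iterates to 0. Index
   these chains backwards from the first entry into the unit ball; consecutive
   norms differ by at most a factor 2, so as N grows an ultrafilter limit gives a
   chain u with D(u_{j+1}) = u_j going up to infinity. Extended below u_0 by
   iterating D, it becomes a chain indexed by Z; passing from rho to rho/2 leaves
   room to perturb it into a strictly increasing one, t, with T(t_{j+1}) <= t_j
   for T := Gamma_{rho/2}. By monotonicity T decays on every order interval
   [t_j, t_{j+1}], so linear interpolation in the variable ln r is a path of
   strict decay. *)
Require Import Defs.
From HB Require Import structures.
From mathcomp Require Import all_boot all_order all_algebra.
From mathcomp Require Import all_classical all_reals all_analysis.
From mathcomp Require Import ring lra zify.
Import Order.TTheory GRing.Theory Num.Theory.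
Import numFieldNormedType.Exports.
Local Open Scope classical_set_scope.
Local Open Scope ring_scope.
Set Implicit Arguments.
Unset Strict Implicit.
Unset Printing Implicit Defensive.

(** * Limits along filters and ultrafilters *)

Lemma cvg_maxr (R : realType) (T : Type) (G : set_system T) {FG : Filter G}
    (f g : T -> R) (a b : R) :
  f x @[x --> G] --> a -> g x @[x --> G] --> b ->
  Num.max (f x) (g x) @[x --> G] --> Num.max a b.
Proof.
move=> fa gb; rewrite maxr_absE; under eq_fun do rewrite maxr_absE.
by apply: cvgMl; apply: cvgD; [exact: cvgD|apply: cvg_norm; exact: cvgB].
Qed.

Lemma cvgr_unique (R : realType) (T : Type) (G : set_system T)
    {PG : ProperFilter G} (f : T -> R) (a b : R) :
  f x @[x --> G] --> a -> f x @[x --> G] --> b -> a = b.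
Proof. by move=> fa fb; exact: (cvg_unique (@Rhausdorff R) fa fb). Qed.

(** Compactness gives a cluster point of the image filter. An ultrafilter contains each set or its
    complement, so this cluster point is a limit. *)
Lemma ultra_cvg_compact (T : Type) (V : topologicalType) (A : set V)
    (U : set_system T) {UU : UltraFilter U} (f : T -> V) :
  compact A -> (\forall x \near U, A (f x)) -> exists l : V, f x @[x --> U] --> l.
Proof.
move=> cA Af; have [l [_ fl]] := cA (f @ U) _ Af.
exists l => B lB; have [//|UB] := in_ultra_setVsetC (f @^-1` B) UU.
by have [y [/= yB]] := fl (~` B) B UB lB.
Qed.

(** * The class [Kinf]: inverses, compositions, minima and maxima *)

Section ClassKinf.
Variable R : realType.
Implicit Types (f g : R -> R) (r x y : R).

Lemma Kinf0 g : Kinf g -> g 0 = 0.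
Proof. by case. Qed.

Lemma Kinf_ge0 g r : Kinf g -> 0 <= r -> 0 <= g r.
Proof. by case=> _ [+ _]; apply. Qed.

Lemma Kinf_lt g r1 r2 : Kinf g -> 0 <= r1 -> r1 < r2 -> g r1 < g r2.
Proof. by case=> _ [_ [_ [+ _]]]; apply. Qed.

Lemma Kinf_le g r1 r2 : Kinf g -> 0 <= r1 -> r1 <= r2 -> g r1 <= g r2.
Proof.
move=> Kg r1_ge0; rewrite le_eqVlt => /predU1P[->//|r12].
exact/ltW/Kinf_lt.
Qed.

Lemma Kinf_gt0 g r : Kinf g -> 0 < r -> 0 < g r.
Proof. by move=> Kg r_gt0; rewrite -(Kinf0 Kg) Kinf_lt. Qed.

Lemma Kinf_lt_rev g r1 r2 : Kinf g -> 0 <= r2 -> g r1 < g r2 -> r1 < r2.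
Proof.
move=> Kg r2_ge0; apply: contraTT; rewrite -!leNgt => r21.
exact: Kinf_le.
Qed.

Lemma Kinf_le_rev g r1 r2 : Kinf g -> 0 <= r2 -> g r1 <= g r2 -> r1 <= r2.
Proof.
move=> Kg r2_ge0; apply: contraTT; rewrite -!ltNge => r21.
exact: Kinf_lt.
Qed.

Lemma Kinf_inj g r1 r2 : Kinf g -> 0 <= r1 -> 0 <= r2 -> g r1 = g r2 -> r1 = r2.
Proof.
move=> Kg r1_ge0 r2_ge0 e; apply/eqP; rewrite eq_le.
by rewrite (Kinf_le_rev Kg r2_ge0) ?e// (Kinf_le_rev Kg r1_ge0) ?e.
Qed.

Lemma Kinf_surj g y : Kinf g -> 0 <= y -> exists x, 0 <= x /\ g x = y.
Proof.
move=> Kg y_ge0; case: (Kg) => g0 [_ [gc [_ gub]]].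
have [b [b_ge0 yb]] := gub y.
have gcb : {within `[0, b], continuous g}.
  apply: continuous_subspaceW gc => x /=.
  by rewrite in_itv /= => /andP[].
have [|x] := IVT b_ge0 gcb (v := y).
  have gb_ge0 := le_trans y_ge0 yb.
  by rewrite g0 (min_idPl gb_ge0) (max_idPr gb_ge0) y_ge0.
by rewrite in_itv /= => /andP[x_ge0 _] gx; exists x.
Qed.

(** A strictly increasing map onto the half-line cannot jump, so continuity comes for free. The
    later constructions of members of the class go through this criterion. *)
Lemma surjective_Kinf g : g 0 = 0 ->
  (forall r1 r2, 0 <= r1 -> r1 < r2 -> g r1 < g r2) ->
  (forall y, 0 <= y -> exists x, 0 <= x /\ g x = y) -> Kinf g.
Proof.
move=> g0 gI gS.
have gI_rev x y : 0 <= y -> g x < g y -> x < y.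
  move=> y_ge0; apply: contraTT; rewrite -!leNgt le_eqVlt => /predU1P[->//|yx].
  exact/ltW/gI.
have g_ge0 r : 0 <= r -> 0 <= g r.
  rewrite le_eqVlt => /predU1P[<-|r_gt0]; first by rewrite g0.
  by rewrite -g0 ltW// gI.
split=> //; split=> //; split; last first.
  split=> // M; have [|x [x_ge0 gx]] := gS (Num.max 0 M).
    by rewrite le_max lexx.
  by exists x; rewrite gx le_max lexx orbT.
apply/subspace_continuousP => x /= x_ge0; apply/cvgrPdist_lt => e e_gt0.
rewrite near_withinE.
have [|q [q_ge0 gq]] := gS (g x + e); first exact: addr_ge0 (g_ge0 _ x_ge0) (ltW e_gt0).
have xq : x < q by apply: gI_rev => //; rewrite gq ltrDl.
have up : \forall t \near x, 0 <= t -> g t < g x + e.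
  near=> t => t_ge0; rewrite -gq; apply: gI => //.
  by near: t; exact: lt_nbhsl.
have lo : \forall t \near x, 0 <= t -> g x - e < g t.
  (* A negative level has no preimage, but it lies below every value of [g] on the half-line. *)
  have [gxe|gxe] := ltP (g x - e) 0.
    by near=> t => t_ge0; apply: lt_le_trans gxe _; exact: g_ge0.
  have [p [p_ge0 gp]] := gS _ gxe.
  have px : p < x by apply: gI_rev => //; rewrite gp ltrBlDr ltrDl.
  near=> t => t_ge0; rewrite -gp; apply: gI => //.
  by near: t; exact: lt_nbhsr.
near=> t => /= t_ge0; rewrite distrC ltr_distl.
by apply/andP; split; move: t_ge0; near: t.
Unshelve. all: by end_near. Qed.

Lemma Kinf_cvg (T : Type) (G : set_system T) {FG : Filter G} g (f : T -> R) (a : R) :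
  Kinf g -> (forall t, 0 <= f t) -> 0 <= a ->
  f t @[t --> G] --> a -> g (f t) @[t --> G] --> g a.
Proof.
move=> Kg f_ge0 a_ge0 fa; case: Kg => _ [_ [/subspace_continuousP gc _]].
have gca := gc a a_ge0.
have fwa : f t @[t --> G] --> within [set x : R | 0 <= x] (nbhs a).
  move=> A wA; have := fa _ wA; rewrite !nbhs_simpl /=.
  by apply: filterS => t; apply.
exact: cvg_comp fwa gca.
Qed.

Lemma Kinf_comp f g : Kinf f -> Kinf g -> Kinf (f \o g).
Proof.
move=> Kf Kg; apply: surjective_Kinf => /= [|r1 r2 r1_ge0 r12|y y_ge0].
- by rewrite (Kinf0 Kg) (Kinf0 Kf).
- by apply: Kinf_lt => //; [exact: Kinf_ge0|exact: Kinf_lt].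
- have [x [x_ge0 fx]] := Kinf_surj Kf y_ge0.
  have [z [z_ge0 gz]] := Kinf_surj Kg x_ge0.
  by exists z; rewrite gz.
Qed.

Lemma Kinf_scale (c : R) g : 0 < c -> Kinf g -> Kinf (fun r => c * g r).
Proof.
move=> c_gt0 Kg; apply: surjective_Kinf => [|r1 r2 r1_ge0 r12|y y_ge0].
- by rewrite (Kinf0 Kg) mulr0.
- by rewrite ltr_pM2l//; exact: Kinf_lt.
- have [|x [x_ge0 gx]] := @Kinf_surj g (y / c) Kg.
    by rewrite divr_ge0// ltW.
  by exists x; rewrite gx mulrC divfK// gt_eqF.
Qed.

Lemma KinvP g y : Kinf g -> 0 <= y -> 0 <= Kinv g y /\ g (Kinv g y) = y.
Proof.
by move=> Kg y_ge0; rewrite /Kinv; case: xgetP => // /(_ _)/= H;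
   have [x /H] := Kinf_surj Kg y_ge0.
Qed.

Lemma Kinf_K g x : Kinf g -> 0 <= x -> Kinv g (g x) = x.
Proof.
move=> Kg x_ge0; have [] := KinvP Kg (Kinf_ge0 Kg x_ge0).
by move=> k_ge0; exact: Kinf_inj.
Qed.

Lemma Kinf_Kinv g : Kinf g -> Kinf (Kinv g).
Proof.
move=> Kg; apply: surjective_Kinf => [|r1 r2 r1_ge0 r12|y y_ge0].
- by rewrite -[X in Kinv _ X](Kinf0 Kg) Kinf_K.
- have [_ e1] := KinvP Kg r1_ge0.
  have [? e2] := KinvP Kg (le_trans r1_ge0 (ltW r12)).
  by apply: (Kinf_lt_rev Kg) => //; rewrite e1 e2.
- by exists (g y); rewrite Kinf_K//; split => //; exact: Kinf_ge0.
Qed.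

Lemma Kinf_min f g : Kinf f -> Kinf g -> Kinf (fun r => Num.min (f r) (g r)).
Proof.
move=> Kf Kg; apply: surjective_Kinf => [|r1 r2 r1_ge0 r12|y y_ge0].
- by rewrite (Kinf0 Kf) (Kinf0 Kg) minxx.
- rewrite lt_min !gt_min (Kinf_lt Kf)//= (Kinf_lt Kg)//.
  by rewrite orbT.
- have [p [p_ge0 fp]] := Kinf_surj Kf y_ge0.
  have [q [q_ge0 gq]] := Kinf_surj Kg y_ge0.
  have [pq|/ltW qp] := leP p q.
    (* For a minimum the larger preimage of [y] works: there the other function has already reached
       [y]. *)
    exists q; split=> //; rewrite gq; apply/min_idPr.
    by rewrite -fp; exact: Kinf_le.
  exists p; split=> //; rewrite fp; apply/min_idPl.
  by rewrite -gq; exact: Kinf_le.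
Qed.

Lemma Kinf_max f g : Kinf f -> Kinf g -> Kinf (fun r => Num.max (f r) (g r)).
Proof.
move=> Kf Kg; apply: surjective_Kinf => [|r1 r2 r1_ge0 r12|y y_ge0].
- by rewrite (Kinf0 Kf) (Kinf0 Kg) maxxx.
- rewrite gt_max !lt_max (Kinf_lt Kf)//= (Kinf_lt Kg)//.
  by rewrite orbT.
- have [p [p_ge0 fp]] := Kinf_surj Kf y_ge0.
  have [q [q_ge0 gq]] := Kinf_surj Kg y_ge0.
  have [pq|/ltW qp] := leP p q.
    exists p; split=> //; rewrite fp; apply/max_idPl.
    by rewrite -gq; exact: Kinf_le.
  exists q; split=> //; rewrite gq; apply/max_idPr.
  by rewrite -fp; exact: Kinf_le.
Qed.

Lemma Kinf_family_bounds (I : finType) (f : I -> R -> R) (i0 : I) :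
  (forall i, Kinf (f i)) ->
  exists fmin fmax : R -> R, [/\ Kinf fmin, Kinf fmax &
    forall i r, fmin r <= f i r <= fmax r].
Proof.
move=> Kf.
suff [fmin [fmax [Kmin Kmax fP]]] : exists fmin fmax : R -> R,
    [/\ Kinf fmin, Kinf fmax &
        forall i, i \in enum I -> forall r, fmin r <= f i r <= fmax r].
  by exists fmin, fmax; split=> // i r; apply: fP; rewrite mem_enum.
elim: (enum I) => [|i s [fmin [fmax [Kmin Kmax IH]]]].
  (* The induction starts from [f i0], since minimum and maximum have no neutral element inside the
     class. *)
  by exists (f i0), (f i0); split.
exists (fun r => Num.min (f i r) (fmin r)), (fun r => Num.max (f i r) (fmax r)).
split; [exact: Kinf_min|exact: Kinf_max|move=> k].
rewrite in_cons => /predU1P[->|ks] r.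
  by rewrite ge_min le_max lexx.
by have /andP[h1 h2] := IH _ ks r; rewrite ge_min le_max h1 h2 !orbT.
Qed.

End ClassKinf.

(** * The maximum norm on a finite index set *)

Section SupNorm.
Variables (R : realType) (I : finType).
Implicit Types s t : I -> R.

Lemma le_nrm s i : `|s i| <= nrm s.
Proof. exact: le_bigmax. Qed.

Lemma nrm_leP s M : 0 <= M -> (forall i, `|s i| <= M) -> nrm s <= M.
Proof. by move=> M_ge0 sM; apply/bigmax_leP; split. Qed.

Lemma nrm_ge0 s : 0 <= nrm s.
Proof. exact: bigmax_ge_id. Qed.

Lemma nrm_lt s M : 0 < M -> (forall i, `|s i| < M) -> nrm s < M.
Proof. by move=> M_ge0 sM; apply/bigmax_ltP; split. Qed.

Lemma nonneg_le_nrm s i : s i <= nrm s.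
Proof. exact: le_trans (ler_norm _) (le_nrm s i). Qed.

Lemma nonneg_nrm_le s M : nonneg s -> 0 <= M -> (forall i, s i <= M) -> nrm s <= M.
Proof. by move=> s_ge0 M_ge0 sM; apply: nrm_leP => // i; rewrite ger0_norm. Qed.

Lemma nrm_mono s t : nonneg s -> vle s t -> nrm s <= nrm t.
Proof.
move=> s0 st; apply: nonneg_nrm_le => [//||i]; first exact: nrm_ge0.
exact: le_trans (st i) (nonneg_le_nrm _ _).
Qed.

Lemma nrm_eq0 s : nrm s = 0 -> s = (fun=> 0).
Proof.
by move=> s0; apply/funext => i; apply/eqP; rewrite -normr_le0 -s0 le_nrm.
Qed.

Lemma nrm_cvg (T : Type) (G : set_system T) {FG : Filter G} (f : T -> I -> R) s :
  (forall i, f x i @[x --> G] --> s i) -> nrm (f x) @[x --> G] --> nrm s.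
Proof.
move=> fs; apply/cvgrPdist_lt => e e_gt0.
have h : \forall x \near G, forall i, `|s i - f x i| < e / 2.
  by apply: filter_forall => i; move/cvgrPdist_lt: (fs i); apply; rewrite divr_gt0.
apply: filterS h => x hx.
apply: (@le_lt_trans _ _ (e / 2)); last by rewrite ltr_pdivrMr// ltr_pMr// ltr1n.
rewrite ler_distl; apply/andP; split; rewrite ?lerBlDr.
  apply: nrm_leP => [|i]; first by rewrite addr_ge0 ?nrm_ge0// divr_ge0 ?ltW.
  have -> : f x i = s i - (s i - f x i) by rewrite opprB addrC subrK.
  by rewrite (le_trans (ler_normB _ _))// lerD ?le_nrm// ltW.
apply: nrm_leP => [|i]; first by rewrite addr_ge0 ?nrm_ge0// divr_ge0 ?ltW.
have -> : s i = f x i + (s i - f x i) by rewrite addrC subrK.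
by rewrite (le_trans (ler_normD _ _))// lerD ?le_nrm// ltW.
Qed.

End SupNorm.

(** * Descending and ascending chains of a monotone operator with the MBI property *)

Section DecayChain.
Variables (R : realType) (I : finType) (i0 : I) (F : (I -> R) -> I -> R).
Variables phi kappa : R -> R.
(** Continuity is stated for all proper filters on [nat] because it serves both at infinity and
    along an ultrafilter. [F_kappa] bounds every component of a decaying point below in terms of its
    norm. *)
Hypotheses (F_ge0 : forall s, nonneg s -> nonneg (F s))
  (F_mono : forall s t, nonneg s -> nonneg t -> vle s t -> vle (F s) (F t))
  (F_cvg : forall (G : set_system nat), ProperFilter G ->
     forall (f : nat -> I -> R) s i, (forall n, nonneg (f n)) -> nonneg s ->
     (forall j, f n j @[n --> G] --> s j) -> F (f n) i @[n --> G] --> F s i)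
  (Kphi : Kinf phi)
  (F_MBI : forall s b, nonneg s -> nonneg b -> vle s (vmax b (F s)) ->
     nrm s <= phi (nrm b))
  (Kkappa : Kinf kappa)
  (F_kappa : forall s, nonneg s -> forall i, kappa (nrm s) <= F s i).
Implicit Types s t : I -> R.

(** The MBI inequality with [b = 0] leaves [nrm s <= phi 0 = 0]. *)
Lemma post_fixpoint_eq0 s : nonneg s -> vle s (F s) -> s = (fun=> 0).
Proof.
move=> s_ge0 sF; apply: nrm_eq0.
have n0 : nrm (fun _ : I => 0 : R) = 0.
  by apply/eqP; rewrite eq_le nrm_ge0 nrm_leP// => i; rewrite normr0.
apply/eqP; rewrite eq_le nrm_ge0 -[leRHS](Kinf0 Kphi) -n0 F_MBI// => i.
by rewrite /vmax le_max sF orbT.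
Qed.

Definition decaying s := nonneg s /\ vle (F s) s.

(* Tarski: the supremum of the post-fixed points of [s |-> N 1 (+) F s], which
   are bounded by the MBI property, is a fixed point. *)
Lemma decaying_above (N : R) : 0 <= N -> exists w, decaying w /\ forall i, N <= w i.
Proof.
move=> N_ge0; pose b (_ : I) := N.
have b_ge0 : nonneg b by move=> i.
pose A := [set s | nonneg s /\ vle s (vmax b (F s))].
pose E i := [set s i | s in A].
have Ab : A b by split=> // i; rewrite /vmax le_max lexx.
have Eub i : has_ubound (E i).
  exists (phi (nrm b)) => _ [s [s_ge0 sb] <-].
  exact: le_trans (nonneg_le_nrm _ _) (F_MBI s_ge0 b_ge0 sb).
pose w i := sup (E i).
have Aw s : A s -> vle s w by move=> As i; apply: ub_le_sup => //; exists s.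
have w_ge0 : nonneg w by move=> i; exact: le_trans N_ge0 (Aw _ Ab i).
have wFw : vle w (vmax b (F w)).
  move=> i; apply: ge_sup; first by exists (b i); exists b.
  move=> _ [s As <-]; have [s_ge0 sF] := As.
  apply: le_trans (sF i) _; rewrite /vmax ge_max !le_max lexx /=.
  by rewrite (F_mono s_ge0 w_ge0 (Aw _ As)) orbT.
have m_ge0 : nonneg (vmax b (F w)) by move=> i; rewrite /vmax le_max N_ge0.
(* The image of the supremum [w] lies in [A] again, hence below [w]; this yields [F w <= w]. *)
have Am : A (vmax b (F w)).
  split=> // i; rewrite {1}/vmax ge_max; apply/andP; split.
    by rewrite /vmax le_max lexx.
  by rewrite [leRHS]/vmax le_max (F_mono w_ge0 m_ge0 wFw) orbT.
exists w; split; last exact: Aw Ab.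
split=> // i; apply: le_trans (Aw _ Am i).
by rewrite /vmax le_max lexx orbT.
Qed.

(* One step down: the factor 1/2 keeps consecutive points comparable, which
   yields the compactness used in [ascending_chain]. *)
Definition descend s i : R := Num.max (F s i) (s i / 2).

Lemma descend_ge0 s : nonneg s -> nonneg (descend s).
Proof. by move=> s_ge0 i; rewrite /descend le_max F_ge0. Qed.

Lemma descend_le s : decaying s -> vle (descend s) s.
Proof.
move=> [s_ge0 Fs] i; rewrite /descend ge_max Fs /=.
by have := s_ge0 i; lra.
Qed.

Lemma descend_decaying s : decaying s -> decaying (descend s).
Proof.
move=> ds; have [s_ge0 Fs] := ds; have D_ge0 := descend_ge0 s_ge0.
split=> // i; rewrite [leRHS]/descend le_max.
by rewrite (F_mono D_ge0 s_ge0 (descend_le ds)).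
Qed.

Lemma iter_descend_decaying n s : decaying s -> decaying (iter n descend s).
Proof. by move=> ds; elim: n => //= n; exact: descend_decaying. Qed.

Lemma nrm_descend s : nonneg s -> nrm s <= 2 * nrm (descend s).
Proof.
move=> s_ge0; apply: nonneg_nrm_le => // [|i]; first by rewrite mulr_ge0 ?nrm_ge0.
have : s i / 2 <= nrm (descend s).
  by apply: le_trans (nonneg_le_nrm _ i); rewrite /descend le_max lexx orbT.
lra.
Qed.

Lemma descend_cvg (G : set_system nat) (f : nat -> I -> R) s i :
  ProperFilter G -> (forall n, nonneg (f n)) -> nonneg s ->
  (forall i, f n i @[n --> G] --> s i) ->
  descend (f n) i @[n --> G] --> descend s i.
Proof.
move=> PG f_ge0 s_ge0 fs.
have h1 : F (f n) i @[n --> G] --> F s i by exact: F_cvg.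
have h2 : f n i / 2 @[n --> G] --> s i / 2 by apply: cvgMl; exact: fs.
exact: cvg_maxr h1 h2.
Qed.

(** Each component equals either [F s i] or its own half, hence 0; in both cases [s i <= F s i], so
    [s] is a post-fixed point. *)
Lemma descend_fix_eq0 s : nonneg s -> (forall i, descend s i = s i) -> s = (fun=> 0).
Proof.
move=> s_ge0 Ds; apply: post_fixpoint_eq0 => // i.
have := Ds i; rewrite /descend maxEle; case: ifP => [_ e|_ ->]; last exact: lexx.
have := F_ge0 s_ge0 i; have := s_ge0 i; lra.
Qed.

(** By continuity the recursion passes to the limit, which becomes a fixed point of [descend]. The
    two alternatives cover chains read downwards and upwards. *)
Lemma descend_limit_eq0 (x : nat -> I -> R) s :
  (forall n, nonneg (x n)) -> (forall i, x n i @[n --> \oo] --> s i) ->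
  (forall n i, descend (x n) i = x n.+1 i) \/
  (forall n i, descend (x n.+1) i = x n i) -> s = (fun=> 0).
Proof.
move=> x_ge0 xs step.
have s_ge0 : nonneg s by move=> i; apply: cvgr_to_ge (xs i) (nearW _ _) => n; exact: x_ge0.
have xsS i : x n.+1 i @[n --> \oo] --> s i.
  by have := xs i; rewrite -(cvg_shiftS (fun n => x n i)).
apply: descend_fix_eq0 => // i.
case: step => step.
  apply: (cvgr_unique (descend_cvg _ x_ge0 s_ge0 xs)).
  by under eq_fun do rewrite step; exact: xsS.
apply: (cvgr_unique (descend_cvg _ (fun n => x_ge0 n.+1) s_ge0 xsS)).
by under eq_fun do rewrite step; exact: xs.
Qed.

Lemma iter_descend_cvg0 s i :
  decaying s -> iter n descend s i @[n --> \oo] --> (0 : R).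
Proof.
move=> ds; pose x n := iter n descend s.
have dx n : decaying (x n) by exact: iter_descend_decaying.
have x_ge0 n : nonneg (x n) by have [] := dx n.
have xc j : cvgn (fun n => x n j).
  apply: nonincreasing_is_cvgn.
    by apply/nonincreasing_seqP => n; exact: descend_le (dx n) j.
  by exists 0 => _ [n _ <-]; exact: x_ge0.
have := @descend_limit_eq0 x (fun j => limn (fun n => x n j)) x_ge0 xc
  (or_introl (fun n j => erefl _)).
by move=> /(congr1 (fun l => l i)) <-; exact: xc.
Qed.

(* Descend from arbitrarily high decaying points until the norm drops below 1,
   and read the chains backwards: their j-th points have norm at most 2^j, so an
   ultrafilter limit of the chains exists. *)
Lemma ascending_chain : exists u : nat -> I -> R,
  [/\ forall j, decaying (u j), forall j i, descend (u j.+1) i = u j i &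
      forall i, 0 < u 0%N i].
Proof.
(* The bound [N + 2] exceeds 1, so the first entry time [m N] into the unit ball is positive. *)
have /choice [w wP] : forall N : nat, exists w, decaying w /\ forall i, N.+2%:R <= w i.
  by move=> N; exact: decaying_above.
have dw N : decaying (w N) by have [] := wP N.
pose c N k := iter k descend (w N).
have dc N k : decaying (c N k) by exact: iter_descend_decaying.
have c_ge0 N k : nonneg (c N k) by have [] := dc N k.
have hit N : exists k, nrm (c N k) <= 1.
  have /cvgrPdist_lt/(_ 1 ltr01) : nrm (c N n) @[n --> \oo] --> nrm (fun _ : I => 0 : R).
    by apply: nrm_cvg => i; exact: iter_descend_cvg0.
  rewrite (_ : nrm _ = 0); last first.
    by apply/eqP; rewrite eq_le nrm_ge0 nrm_leP// => i; rewrite normr0.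
  case=> k _ /(_ k (leqnn k)) /=; rewrite sub0r normrN ger0_norm ?nrm_ge0//.
  by move=> /ltW; exists k.
pose m N := ex_minn (hit N).
have nrm_m N : nrm (c N (m N)) <= 1 by rewrite /m; case: ex_minnP.
have before_m N k : (k < m N)%N -> 1 < nrm (c N k).
  rewrite /m; case: ex_minnP => p _ pmin kp; rewrite ltNge; apply/negP => /pmin.
  by rewrite leqNgt kp.
have nrm_w N : N.+2%:R <= nrm (w N).
  by apply: le_trans (nonneg_le_nrm _ i0); have [_] := wP N; exact.
have m_gt0 N : (0 < m N)%N.
  rewrite lt0n; apply/eqP => m0; have := nrm_m N; rewrite m0 /c /= leNgt.
  by rewrite (lt_le_trans _ (nrm_w N))// ltr1n.
pose v N j := c N (m N - j)%N.
have vS N j : (j < m N)%N -> forall i, descend (v N j.+1) i = v N j i.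
  by move=> jm i; rewrite /v -(subnSK jm).
have nrm_v N j : (j <= m N)%N -> nrm (v N j) <= 2 ^+ j.
  elim: j => [|j IH] jm; first by rewrite /v subn0 expr0.
  rewrite exprS; apply: le_trans (nrm_descend (c_ge0 N _)) _.
  rewrite ler_pM2l//; apply: le_trans (IH (ltnW jm)).
  by rewrite le_eqVlt; apply/orP; left; apply/eqP; congr nrm; apply/funext/vS.
(* The start [w N] is the point [v N (m N)], so [N + 2 <= 2 ^ (m N)] and the chain lengths tend to
   infinity. *)
have m_large j : \forall N \near \oo, (j < m N)%N.
  near=> N; rewrite ltnNge; apply/negP => mj.
  have := nrm_v N (m N) (leqnn _); rewrite /v subnn /c /= leNgt => /negP; apply.
  apply: lt_le_trans (nrm_w N).
  apply: (@le_lt_trans _ _ (2 ^+ j)); first by rewrite ler_eXn2l// ltr1n.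
  rewrite -natrX ltr_nat; apply: (@leq_trans N.+1) => //.
  by rewrite ltnS; near: N; exact: nbhs_infty_ge.
(* One ultrafilter makes all components at all positions [j] converge at once. *)
have [U [UU ooU]] := ultraFilterLemma (eventually_filter).
have PU : ProperFilter U by exact: ultra_proper.
have v_bnd j i : \forall N \near U, v N j i \in `[0, 2 ^+ j].
  apply: ooU; apply: filterS (m_large j) => N /ltnW jm.
  by rewrite in_itv /= c_ge0 /= (le_trans (nonneg_le_nrm _ _) (nrm_v _ _ jm)).
have vl j i : exists l : R, v N j i @[N --> U] --> l.
  by apply: (ultra_cvg_compact (@segment_compact R 0 (2 ^+ j))); exact: v_bnd.
pose u j i := lim (v N j i @[N --> U]).
have uP j i : v N j i @[N --> U] --> u j i by have [l] := vl j i; exact: cvgP.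
have u_ge0 j : nonneg (u j).
  by move=> i; apply: cvgr_to_ge (uP j i) _; apply: nearW => N; exact: c_ge0.
have v_ge0 j N : nonneg (v N j) by exact: c_ge0.
exists u; split.
- move=> j; split => // i.
  have Fv := F_cvg (i := i) PU (v_ge0 j) (u_ge0 j) (uP j).
  apply: (ler_cvg_to Fv (uP j i)).
  by apply: nearW => N; have [_] := dc N (m N - j)%N; exact.
- move=> j i; have uS := descend_cvg (i := i) PU (v_ge0 j.+1) (u_ge0 j.+1) (uP j.+1).
  apply: (cvgr_unique uS).
  apply: cvg_trans (uP j i); apply: near_eq_cvg; apply: ooU.
  by apply: filterS (m_large j) => N jm; rewrite vS.
(* Just before entry the norm exceeds 1 and one step at most halves it, so the entry point has norm
   at least 1/2; decay and [F_kappa] pass this on to each component. *)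
- move=> i; apply: (@lt_le_trans _ _ (kappa (1 / 2))).
    by apply: Kinf_gt0 => //; rewrite divr_gt0.
  apply: cvgr_to_ge (uP 0%N i) _; apply: nearW => N.
  have [_ /(_ i)] := dc N (m N); rewrite /v subn0; apply: le_trans.
  apply: le_trans (F_kappa (c_ge0 _ _) i); apply: Kinf_le => //.
  have := before_m N (m N).-1; rewrite prednK// leqnn => /(_ isT) h.
  have := nrm_descend (c_ge0 N (m N).-1).
  rewrite (_ : descend _ = c N (m N)); last first.
    by rewrite /c -{2}(prednK (m_gt0 N)).
  by move: h; lra.
Unshelve. all: by end_near. Qed.

(** If component [i] stayed below [M], then [kappa (nrm (u j)) <= F (u j) i <= u j i <= M] would
    bound the whole chain. Its limit would be 0 although the chain increases from a positive
    point. *)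
Lemma ascending_chain_unbounded (u : nat -> I -> R) :
  (forall j, decaying (u j)) -> (forall j i, descend (u j.+1) i = u j i) ->
  (forall i, 0 < u 0%N i) -> forall i M, exists j, M <= u j i.
Proof.
move=> du uS u0_gt0 i M; apply: contrapT => /forallNP uM.
have u_ge0 j : nonneg (u j) by have [] := du j.
have uM' j : u j i <= M by rewrite leNgt; apply/negP => /ltW; exact: uM.
have M_ge0 : 0 <= M by exact: le_trans (u_ge0 0%N i) (uM' 0%N).
have [B_ge0 kB] := KinvP Kkappa M_ge0.
have uB j k : u j k <= Kinv kappa M.
  apply: le_trans (nonneg_le_nrm _ k) _; apply: (Kinf_le_rev Kkappa) => //.
  rewrite kB; apply: le_trans (F_kappa (u_ge0 j) i) _.
  by have [_ /(_ i)] := du j; move/le_trans; apply.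
have u_mono k : {homo (fun j => u j k) : m n / (m <= n)%N >-> m <= n}.
  by apply/nondecreasing_seqP => j; rewrite -uS; exact: descend_le.
have u_ub k : has_ubound (range (fun j => u j k)).
  by exists (Kinv kappa M) => _ [j _ <-].
have uc k : cvgn (fun j => u j k) by exact: nondecreasing_is_cvgn.
have := @descend_limit_eq0 u (fun k => limn (fun j => u j k)) u_ge0 uc (or_intror uS).
move=> /(congr1 (fun l => l i)) /= lim0.
have := nondecreasing_cvgn_le (u_mono i) (uc i) 0%N.
by rewrite lim0 leNgt u0_gt0.
Qed.

(* The weights [a j] decrease strictly in [j], which makes the barycenters of
   [T (U (j + 1)) < U j] increase strictly even where [U] is stationary. *)
Lemma strict_decay_chain (T : (I -> R) -> I -> R) :
  (forall s, nonneg s -> nonneg (T s)) ->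
  (forall s t, nonneg s -> nonneg t -> vle s t -> vle (T s) (T t)) ->
  (forall s i y, nonneg s -> F s i <= y -> 0 < y -> T s i < y) ->
  exists t : int -> I -> R,
    [/\ forall j i, 0 < t j i, forall j i, t j i < t (j + 1) i,
        forall j, vle (T (t (j + 1))) (t j),
        forall i e, 0 < e -> exists j, t j i < e &
        forall i M, exists j, M <= t j i].
Proof.
move=> T_ge0 T_mono T_lt; have [u [du uS u0_gt0]] := ascending_chain.
(* [Negz n] stands for -(n+1), hence the iterate of order [n.+1]. *)
pose U j := match j with Posz n => u n | Negz n => iter n.+1 descend (u 0%N) end.
have dU j : decaying (U j) by case: j => n /=; [exact: du|exact: (iter_descend_decaying n.+1)].
have U_ge0 j : nonneg (U j) by have [] := dU j.
have US j i : descend (U (j + 1)) i = U j i.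
  case: j => [n|[|n]].
  - have -> : Posz n + 1 = Posz n.+1 by lia.
    exact: uS.
  - by have -> : Negz 0 + 1 = Posz 0 by lia.
  - by have -> : Negz n.+1 + 1 = Negz n by lia.
have U_gt0 j i : 0 < U j i.
  have descend_gt0 s k : 0 < s k -> 0 < descend s k.
    by move=> sk; rewrite /descend lt_max divr_gt0// orbT.
  case: j => n /=.
    by elim: n => [//|n IH]; apply: lt_le_trans IH _; rewrite -uS; exact: descend_le.
  by apply: (descend_gt0); elim: n => [|n IH]; [exact: u0_gt0|exact: descend_gt0].
have U_le j i : U j i <= U (j + 1) i by rewrite -US; exact: descend_le.
have TU j i : T (U (j + 1)) i < U j i.
  by apply: T_lt => //; rewrite -US /descend le_max lexx.
(* A decreasing logistic weight with values in (0,1). For [j >= 0] it is at most 1/2, so that [t j]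
   is at least half of [U j] and stays unbounded. *)
pose a (j : int) : R := (1 + expR j%:~R)^-1.
have e_gt0 (j : int) : 0 < expR (j%:~R : R) by exact: expR_gt0.
have a_gt0 j : 0 < a j by rewrite invr_gt0 addr_gt0.
have a_lt1 j : a j < 1.
  by rewrite invf_lt1 ?addr_gt0// ltrDl.
have a_dec j : a (j + 1) < a j.
  by rewrite ltf_pV2 ?posrE ?addr_gt0// ltrD2l ltr_expR ltr_int ltrDl.
have a_half (n : nat) : a n <= 1 / 2.
  rewrite div1r lef_pV2 ?posrE ?addr_gt0//.
  by have := expR_ge1Dx (n%:R : R); have := ler0n R n; rewrite -pmulrn; lra.
pose t j i := U j i - a j * (U j i - T (U (j + 1)) i).
have TU_ge0 j i : 0 <= T (U (j + 1)) i by exact: T_ge0.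
have t_gt0 j i : 0 < t j i.
  rewrite /t; have := a_gt0 j; have := a_lt1 j; have := U_gt0 j i.
  have := TU_ge0 j i; move: (T _ i) (U j i) (a j) => x y c; nra.
have t_leU j i : t j i <= U j i.
  by rewrite /t gerBl mulr_ge0 ?(ltW (a_gt0 j))// subr_ge0 ltW.
exists t; split => //.
- move=> j i; rewrite /t.
  have TT : T (U (j + 1)) i <= T (U (j + 1 + 1)) i by apply: T_mono.
  move: (TU j i) (U_le j i) TT (a_gt0 (j + 1)) (a_lt1 (j + 1)) (a_dec j).
  move: (T _ i) (T _ i) (U _ i) (U _ i) (a _) (a _) => x x' y y' c' c; nra.
(* [T (U (j + 1))] separates the two sides: it dominates [T (t (j + 1))] because [t <= U], and it is
   the lower end of the segment containing [t j]. *)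
- move=> j i; apply: (@le_trans _ _ (T (U (j + 1)) i)).
    by apply: T_mono => // k; exact/ltW.
  rewrite /t; move: (TU j i) (a_lt1 j); move: (T _ i) (U _ _) (a _) => x y c; nra.
- move=> i e e0; have /cvgrPdist_lt/(_ e e0) := iter_descend_cvg0 i (du 0%N).
  case=> n _ /(_ n.+1 (leqnSn n)) /=.
  rewrite sub0r normrN => h; exists (Negz n); apply: le_lt_trans (t_leU _ _) _.
  exact: le_lt_trans (ler_norm _) h.
- move=> i M; have [n nM] := ascending_chain_unbounded du uS u0_gt0 i (2 * Num.max M 0).
  exists (Posz n); rewrite /t; move: (TU_ge0 n i) (U_gt0 n i) (a_half n) (a_gt0 n) nM.
  rewrite /= -/(U (Posz n)); move: (T _ i) (u n i) (a n) => x y c.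
  have : M <= Num.max M 0 by rewrite le_max lexx.
  have : 0 <= Num.max M 0 by rewrite le_max lexx orbT.
  move: (Num.max M 0) => M'; nra.
Qed.

End DecayChain.

(** * Piecewise linear interpolation of a strictly increasing two-sided sequence *)

Section Interpolation.
Variables (R : realType) (c : int -> R).
Hypothesis c_lt : forall j, c j < c (j + 1).
Implicit Types x y : R.

Definition interp x : R :=
  let j := Num.floor x in c j + (x - j%:~R) * (c (j + 1) - c j).

(** At the right end point the floor is already [j + 1], but neighbouring affine pieces agree at
    their common node. *)
Lemma interpE (j : int) x : j%:~R <= x <= (j + 1)%:~R ->
  interp x = c j + (x - j%:~R) * (c (j + 1) - c j).
Proof.
move=> /andP[jx]; rewrite le_eqVlt => /predU1P[->|xj]; rewrite /interp.
  by rewrite intrKfloor intrD; ring.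
by rewrite (floor_def (m := j)) // jx.
Qed.

Lemma interp_int (j : int) : interp j%:~R = c j.
Proof. by rewrite /interp intrKfloor subrr mul0r addr0. Qed.

(** The extreme slopes of finitely many pieces serve as constants. The induction adds one piece and
    splits an interval at the node [b] if it straddles it. *)
Lemma interp_bilipschitz (a : int) (m : nat) : exists l L : R,
  0 < l /\ forall x y, a%:~R <= x -> x <= y -> y <= (a + m%:Z)%:~R ->
    l * (y - x) <= interp y - interp x <= L * (y - x).
Proof.
elim: m => [|m [l [L [l_gt0 IH]]]].
  exists 1, 1; split=> // x y ax xy ya; rewrite addr0 in ya.
  have -> : y = x by apply/eqP; rewrite eq_le xy (le_trans ya).
  by rewrite !subrr mulr0 lexx.
pose b := a + m%:Z; pose d := c (b + 1) - c b.
have d_gt0 : 0 < d by rewrite subr_gt0.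
have last_piece x y : b%:~R <= x -> x <= y -> y <= (b + 1)%:~R ->
    interp y - interp x = d * (y - x).
  move=> bx xy yb.
  rewrite (interpE (j := b)) ?yb ?(le_trans bx xy)//.
  rewrite (interpE (j := b)) ?bx ?(le_trans xy yb)// -/d; ring.
exists (Num.min l d), (Num.max L d); split; first by rewrite lt_min l_gt0.
have weaken lo hi p v : 0 <= p -> lo * p <= v <= hi * p ->
    Num.min l d <= lo -> hi <= Num.max L d ->
    Num.min l d * p <= v <= Num.max L d * p.
  move=> p_ge0 /andP[h1 h2] h3 h4; apply/andP; split.
    by apply: le_trans h1; rewrite ler_wpM2r.
  by apply: le_trans h2 _; rewrite ler_wpM2r.
move=> x y ax xy; rewrite (_ : a + m.+1%:Z = b + 1); last by rewrite /b; lia.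
move=> yb1; have [yb|/ltW by_] := leP y b%:~R.
  apply: (weaken l L); rewrite ?subr_ge0 ?ge_min ?le_max ?lexx//.
  exact: IH.
have [xb|/ltW bx] := leP x b%:~R; last first.
  apply: (weaken d d); rewrite ?subr_ge0 ?ge_min ?le_max ?lexx ?orbT//.
  by rewrite last_piece// lexx.
have h1 : Num.min l d * (b%:~R - x) <= interp b%:~R - interp x
    <= Num.max L d * (b%:~R - x).
  apply: (weaken l L); rewrite ?subr_ge0 ?ge_min ?le_max ?lexx//.
  exact: IH.
have h2 : Num.min l d * (y - b%:~R) <= interp y - interp b%:~R
    <= Num.max L d * (y - b%:~R).
  apply: (weaken d d); rewrite ?subr_ge0 ?ge_min ?le_max ?lexx ?orbT//.
  by rewrite last_piece// lexx.
by move: h1 h2 => /andP[? ?] /andP[? ?]; apply/andP; split; lra.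
Qed.

Lemma interp_floor_bounds x :
  c (Num.floor x) <= interp x <= c (Num.floor x + 1).
Proof.
have /andP[h1 h2] := floor_itv x; rewrite intrD in h2.
rewrite /interp; move: (c_lt (Num.floor x)) => h; apply/andP; split.
  by rewrite lerDl mulr_ge0 ?subr_ge0// ltW.
by move: h1 h2 h; set f := _%:~R; set u := c _; set v := c _; nra.
Qed.

Lemma interp_lt x y : x < y -> interp x < interp y.
Proof.
move=> xy; pose a := Num.floor x.
have ay : a <= Num.floor y by apply/Num.Theory.le_floor/ltW.
have [m am] : exists m : nat, a + m%:Z = Num.floor y + 1.
  by exists (absz (Num.floor y + 1 - a)%R); lia.
have [l [L [l_gt0]]] := interp_bilipschitz a m.
have /andP[h1 _] := floor_itv x; have /andP[_ h2] := floor_itv y.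
have yb : y <= (a + m%:Z)%:~R by rewrite am ltW.
move=> /(_ x y h1 (ltW xy) yb)/andP[+ _].
by rewrite -subr_gt0; apply: lt_le_trans; rewrite mulr_gt0// subr_gt0.
Qed.

Lemma interp_surj y : (exists j, c j <= y) -> (exists j, y <= c j) ->
  exists x, interp x = y.
Proof.
move=> [a ay] [b yb].
have [j /andP[jy yj]] : exists j, c j <= y <= c (j + 1).
  (* If [b <= a], monotonicity forces [y = c a]; otherwise the search climbs from [a] until a node
     passes [y]. *)
  have [ba|ab] := leP b a.
    exists a; rewrite ay (le_trans yb)//; apply: le_trans (ltW (c_lt a)).
    rewrite -!interp_int; move: ba; rewrite le_eqVlt => /predU1P[->//|ba].
    by apply/ltW/interp_lt; rewrite ltr_int.
  have [m bm] : exists m : nat, b = a + m%:Z by exists (absz (b - a)%R); lia.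
  move: yb; rewrite bm; elim: m {bm} => [|m IH] ym.
    by exists a; rewrite ay; apply: le_trans ym _; rewrite addr0 ltW.
  have [/IH//|/ltW my] := leP y (c (a + m%:Z)).
  by exists (a + m%:Z); rewrite my (_ : _ + 1 = a + m.+1%:Z)//; lia.
pose d := c (j + 1) - c j; have d_gt0 : 0 < d by rewrite subr_gt0.
exists (j%:~R + (y - c j) / d).
rewrite (interpE (j := j)).
  by rewrite -/d; field; exact: lt0r_neq0.
rewrite lerDl divr_ge0 ?subr_ge0// ?(ltW (c_lt j))//=.
by rewrite intrD lerD2l ler_pdivrMr// mul1r lerD2r.
Qed.

End Interpolation.

(** * Bounds for the exponential and for compact sets of positive numbers *)

(** Both bounds come from [1 + z <= expR z]: with [z = y - x] for the lower one, with [z = x - y]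
    for the upper one. *)
Lemma expR_bilipschitz (R : realType) (N x y : R) : - N <= x -> x <= y -> y <= N ->
  (expR N)^-1 * (y - x) <= expR y - expR x <= expR N * (y - x).
Proof.
move=> Nx xy yN; have d_ge0 : 0 <= y - x by rewrite subr_ge0.
have := expR_ge1Dx (y - x); have := expR_ge1Dx (x - y).
rewrite -expRN => h1 h2.
have ex : expR (- N) <= expR x by rewrite ler_expR.
have ey : expR y <= expR N by rewrite ler_expR.
have exy : expR y = expR x * expR (y - x) by rewrite -expRD; congr expR; ring.
have eyx : expR x = expR y * expR (x - y) by rewrite -expRD; congr expR; ring.
have := expR_gt0 (- N); have := expR_gt0 x; have := expR_gt0 y.
move=> y0 x0 N0; apply/andP; split.
  apply: (@le_trans _ _ (expR x * (y - x))); first by rewrite ler_wpM2r.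
  by rewrite exy; nra.
apply: (@le_trans _ _ (expR y * (y - x))); last by rewrite ler_wpM2r.
by rewrite eyx; nra.
Qed.

Lemma compact_pos_bounds (R : realType) (K : set R) : compact K -> K `<=` [set x | 0 < x] ->
  exists a b : R, 0 < a /\ forall y, K y -> a <= y <= b.
Proof.
move=> cK K_gt0.
have [M [_ MK]] := compact_bounded cK.
(* [K] is closed and misses 0, so a ball around 0 misses [K]; its radius is the lower bound. *)
have KC : nbhs (0 : R) (~` K).
  apply: open_nbhs_nbhs; split; last by move=> /K_gt0 /=; rewrite ltxx.
  by apply: closed_openC; apply: compact_closed => //; exact: Rhausdorff.
have [e /= e_gt0 eK] := (nbhs_ballP _ _).1 KC.
exists e, (M + 1); split=> // y Ky; apply/andP; split.
  rewrite leNgt; apply/negP => ye; apply: (eK y) => //; rewrite -ball_normE /=.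
  by rewrite sub0r normrN ger0_norm// ltW// K_gt0.
apply: le_trans (ler_norm _) _; apply: (MK (M + 1)) => //.
by rewrite ltrDl.
Qed.

(** * The path through a two-sided chain *)

Section ChainPath.
Variables (R : realType) (I : finType) (t : int -> I -> R).
Hypotheses (t_gt0 : forall j i, 0 < t j i)
  (t_lt : forall j i, t j i < t (j + 1) i)
  (t_small : forall i e, 0 < e -> exists j, t j i < e)
  (t_large : forall i M, exists j, M <= t j i).

(** The path meets [t j] at the radius [expR j]; the negative indices fill the radii below 1. *)
Definition chain_path (r : R) (i : I) : R :=
  if 0 < r then interp (t^~ i) (ln r) else 0.

Lemma chain_path_expR x i : chain_path (expR x) i = interp (t^~ i) x.
Proof. by rewrite /chain_path expR_gt0 expRK. Qed.

Lemma interp_chain_gt0 x i : 0 < interp (t^~ i) x.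
Proof.
have /andP[+ _] := interp_floor_bounds (t_lt^~ i) x.
by apply: lt_le_trans.
Qed.

Lemma interp_chain_surj y i : 0 < y -> exists x, interp (t^~ i) x = y.
Proof.
move=> y_gt0; apply: interp_surj; first by move=> j; exact: t_lt.
  by have [j /ltW] := t_small i y_gt0; exists j.
by have [j] := t_large i y; exists j.
Qed.

Lemma chain_path_Kinf i : Kinf (fun r => chain_path r i).
Proof.
apply: surjective_Kinf => [|r1 r2|y].
- by rewrite /chain_path ltxx.
- rewrite le_eqVlt => /predU1P[<- r2_gt0|r1_gt0 r12].
    by rewrite {1}/chain_path ltxx /chain_path r2_gt0 interp_chain_gt0.
  have r2_gt0 := lt_trans r1_gt0 r12.
  rewrite /chain_path r1_gt0 r2_gt0; apply: interp_lt; first by move=> j; exact: t_lt.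
  by rewrite ltr_ln ?posrE.
- rewrite le_eqVlt => /predU1P[<-|y_gt0].
    by exists 0; rewrite /chain_path ltxx lexx.
  have [x xy] := interp_chain_surj i y_gt0.
  by exists (expR x); rewrite chain_path_expR expR_ge0.
Qed.

Lemma Kinv_chain_path x i :
  Kinv (fun r => chain_path r i) (interp (t^~ i) x) = expR x.
Proof.
rewrite -chain_path_expR.
exact: (Kinf_K (chain_path_Kinf i) (expR_ge0 x)).
Qed.

(** For [ln r] between [j] and [j + 1] the path lies between [t j] and [t (j + 1)], so its image is
    at most [T (t (j + 1)) <= t j]. *)
Lemma chain_path_decay (T : (I -> R) -> I -> R) :
  (forall s s', nonneg s -> nonneg s' -> vle s s' -> vle (T s) (T s')) ->
  vle (T (fun=> 0)) (fun=> 0) -> (forall j, vle (T (t (j + 1))) (t j)) ->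
  forall r, 0 <= r -> vle (T (chain_path r)) (chain_path r).
Proof.
move=> T_mono T0 Tt r; rewrite le_eqVlt => /predU1P[<-|r_gt0].
  suff -> : chain_path 0 = (fun=> 0) by [].
  by apply/funext => i; rewrite /chain_path ltxx.
have b i := interp_floor_bounds (t_lt^~ i) (ln r).
move=> i; rewrite [leRHS]/chain_path r_gt0.
have /andP[+ _] := b i; apply: le_trans; apply: le_trans (Tt _ i).
apply: T_mono => k; rewrite ?/chain_path ?r_gt0.
- by rewrite ltW// interp_chain_gt0.
- exact: ltW.
- by have /andP[] := b k.
Qed.

(** The inverse of a component is [expR] after the inverse of the interpolation, and both factors
    are bi-Lipschitz on bounded intervals. *)
Lemma chain_path_inv_bilipschitz (K : set R) :
  compact K -> K `<=` [set x | 0 < x] ->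
  exists l L : R, 0 < l /\ l <= L /\ forall r1 r2, K r1 -> K r2 -> forall i,
    l * `|r1 - r2| <=
      `|Kinv (fun r => chain_path r i) r1 - Kinv (fun r => chain_path r i) r2| /\
    `|Kinv (fun r => chain_path r i) r1 - Kinv (fun r => chain_path r i) r2| <=
      L * `|r1 - r2|.
Proof.
move=> cK K_gt0; have [a [b [a_gt0 Kab]]] := compact_pos_bounds cK K_gt0.
have /choice [n nP] : forall i, exists n : nat, forall x,
    a <= interp (t^~ i) x <= b -> - n%:R <= x <= n%:R.
  move=> i; have [j ja] := t_small i a_gt0; have [k kb] := t_large i b.
  have lt_interp := interp_lt (t_lt^~ i).
  exists (maxn (absz j) (absz k)) => x /andP[ax xb]; apply/andP; split.
    apply: (@le_trans _ _ (j%:~R)).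
      rewrite (_ : - _ = (- (maxn (absz j) (absz k))%:Z)%:~R); last by rewrite intrN.
      by rewrite ler_int; lia.
    rewrite leNgt; apply/negP => /lt_interp; rewrite (interp_int (t^~ i)).
    by move=> /lt_trans/(_ ja); rewrite ltNge ax.
  apply: (@le_trans _ _ (k%:~R)); last by rewrite pmulrn ler_int; lia.
  rewrite leNgt; apply/negP => /lt_interp; rewrite (interp_int (t^~ i)).
  by move=> /(le_lt_trans kb); rewrite ltNge xb.
(* Maxima and minima over the finite set [I] make the interval and the slopes uniform in [i]. *)
pose N := (\max_i n i)%N.
have NP i x : a <= interp (t^~ i) x <= b -> - N%:R <= x <= N%:R.
  move=> /nP /andP[h1 h2]; have nN : (n i)%:R <= N%:R :> R.
    by rewrite ler_nat; exact: leq_bigmax.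
  by rewrite (le_trans h2 nN) (le_trans _ h1)// lerN2.
have /choice [l /choice [L lLP]] : forall i, exists l L : R,
    0 < l /\ forall x y, - N%:R <= x -> x <= y -> y <= N%:R ->
    l * (y - x) <= interp (t^~ i) y - interp (t^~ i) x <= L * (y - x).
  move=> i; have [l [L [l0 lL]]] :=
    interp_bilipschitz (t_lt^~ i) (- N%:Z) (N + N)%N.
  exists l, L; split=> // x y Nx xy yN; apply: lL => //; first by rewrite intrN.
  by rewrite (_ : - N%:Z + _ = N%:Z)//; lia.
pose l0 := \big[Num.min/1]_i l i; pose L0 := \big[Num.max/1]_i L i.
have l0_gt0 : 0 < l0.
  by apply/bigmin_gtP; split=> // i _; have [] := lLP i.
have L0_ge1 : 1 <= L0 by exact: bigmax_ge_id.
pose E : R := expR N%:R; have E_gt0 : 0 < E by exact: expR_gt0.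
(* Slopes of [expR] lie in [1/E, E] and those of the interpolation in [l0, L0]; the quotients give
   the constants, and the maximum secures [l <= L]. *)
exists (E * L0)^-1, (Num.max (E * L0)^-1 (E / l0)).
split; first by rewrite invr_gt0 mulr_gt0// (lt_le_trans ltr01).
split; first by rewrite le_max lexx.
move=> r1 r2 K1 K2 i.
have [x1 e1] := interp_chain_surj i (K_gt0 _ K1).
have [x2 e2] := interp_chain_surj i (K_gt0 _ K2).
have := Kab _ K1; have := Kab _ K2; rewrite -e1 -e2 !Kinv_chain_path.
move=> /NP/andP[N2 x2N] /NP/andP[N1 x1N] {e1 e2 K1 K2}.
wlog x12 : x1 x2 N1 x1N N2 x2N / x1 <= x2.
  move=> H; have [|/ltW] := leP x1 x2; first exact: H.
  by rewrite distrC (distrC (expR x1)); exact: H.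
have [_ /(_ x1 x2 N1 x12 x2N) /andP[lo hi]] := lLP i.
have /andP[elo ehi] := expR_bilipschitz N1 x12 x2N.
have p_ge0 : 0 <= x2 - x1 by rewrite subr_ge0.
have lo0 : l0 * (x2 - x1) <= interp (t^~ i) x2 - interp (t^~ i) x1.
  by apply: le_trans lo; rewrite ler_wpM2r//; exact: bigmin_le.
have hi0 : interp (t^~ i) x2 - interp (t^~ i) x1 <= L0 * (x2 - x1).
  by apply: le_trans hi _; rewrite ler_wpM2r//; exact: le_bigmax.
have d_ge0 : 0 <= interp (t^~ i) x2 - interp (t^~ i) x1.
  by apply: le_trans lo0; rewrite mulr_ge0// ltW.
rewrite distrC (ger0_norm d_ge0) distrC ger0_norm ?subr_ge0 ?ler_expR//.
have L0_gt0 : 0 < L0 by exact: lt_le_trans ltr01 L0_ge1.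
split.
  apply: le_trans elo; rewrite -/E invfM -mulrA ler_pM2l ?invr_gt0//.
  by rewrite ler_pdivrMl.
apply: le_trans ehi _; rewrite -/E.
apply: (@le_trans _ _ (E / l0 * (interp (t^~ i) x2 - interp (t^~ i) x1))).
  by rewrite -mulrA ler_pM2l// ler_pdivlMl.
by rewrite ler_wpM2r// le_max lexx orbT.
Qed.

End ChainPath.

(** * Gain operators and the two implications *)

Section GainOperator.
Variables (R : realType) (I : finType).
Variables (Ii : I -> {set I}) (gam : I -> I -> R -> R) (mu : I -> (I -> R) -> \bar R).
Hypothesis Hgain : is_gain_operator Ii gam mu.
Implicit Types s : I -> R.

Lemma gain_Kinf i j : j \in Ii i -> Kinf (gam i j).
Proof. by case: Hgain => _ [+ _]; apply. Qed.

Lemma gvec_ge0 s i : nonneg s -> nonneg (gvec Ii gam s i).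
Proof.
by move=> s_ge0 j; rewrite /gvec; case: ifP => // /gain_Kinf/Kinf_ge0; exact.
Qed.

Lemma gvec_vanish s i : vanish_off (Ii i) (gvec Ii gam s i).
Proof. by move=> j jN; rewrite /gvec (negbTE jN). Qed.

Lemma Gamma_fin s i : nonneg s -> mu i (gvec Ii gam s i) \is a fin_num.
Proof.
move=> s_ge0; case: Hgain => _ [_ [_ [_ [_ [_ [/(_ i (Ii i)) [+ _] _]]]]]].
by apply; [exact: gvec_ge0|exact: gvec_vanish].
Qed.

Lemma Gamma_ge0 s : nonneg s -> nonneg (Gamma Ii gam mu s).
Proof.
move=> s_ge0 i; apply: fine_ge0; case: Hgain => _ [_ [_ [+ _]]]; apply.
exact: gvec_ge0.
Qed.

Lemma Gamma_mono s s' : nonneg s -> nonneg s' -> vle s s' ->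
  vle (Gamma Ii gam mu s) (Gamma Ii gam mu s').
Proof.
move=> s0 s'0 ss' i; apply: fine_le; [exact: Gamma_fin|exact: Gamma_fin|].
case: Hgain => _ [_ [_ [_ [_ [+ _]]]]]; apply; [exact: gvec_ge0|exact: gvec_ge0|].
by move=> j; rewrite /gvec; case: ifP => // /gain_Kinf/Kinf_le; apply.
Qed.

Lemma Gamma0 i : Gamma Ii gam mu (fun=> 0) i = 0.
Proof.
rewrite /Gamma (_ : gvec _ _ _ _ = fun=> 0).
  by case: Hgain => _ [_ [_ [_ [[xi [_ /(_ i) [-> _]]] _]]]].
by apply/funext => j; rewrite /gvec; case: ifP => // /gain_Kinf/Kinf0.
Qed.

(** This is (M3) with [J = Ii i], off which every [gvec] vanishes; finitely many convergent
    components give convergence in norm. *)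
Lemma Gamma_cvg (T : Type) (G : set_system T) {FG : Filter G} (f : T -> I -> R) s i :
  (forall x, nonneg (f x)) -> nonneg s -> (forall j, f x j @[x --> G] --> s j) ->
  Gamma Ii gam mu (f x) i @[x --> G] --> Gamma Ii gam mu s i.
Proof.
move=> f_ge0 s_ge0 fs; apply/cvgrPdist_lt => e e_gt0.
case: Hgain => _ [_ [_ [_ [_ [_ [/(_ i (Ii i)) [_ mu_cont] _]]]]]].
have [d [d_gt0 dP]] := mu_cont _ (gvec_ge0 i s_ge0) (@gvec_vanish s i) e e_gt0.
have near_gvec : \forall x \near G, forall j,
    `|gvec Ii gam s i j - gvec Ii gam (f x) i j| < d.
  apply: filter_forall => j; rewrite /gvec; case: ifP => [ji|_].
    have fj_ge0 x : 0 <= f x j by exact: f_ge0.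
    have gj := Kinf_cvg (FG := FG) (gain_Kinf ji) fj_ge0 (s_ge0 j) (fs j).
    by have /cvgrPdist_lt/(_ _ d_gt0) := gj.
  by apply: nearW => x; rewrite subrr normr0.
apply: filterS near_gvec => x xd; rewrite distrC.
apply: dP; [exact: gvec_ge0|exact: gvec_vanish|].
by apply: nrm_lt => // j; rewrite distrC.
Qed.

Section GammaRho.
Variable rho : R -> R.
Hypothesis Krho : Kinf rho.

Lemma Gamma_rho_ge0 s : nonneg s -> nonneg (Gamma_rho Ii gam mu rho s).
Proof.
move=> s_ge0 i; have g_ge0 := Gamma_ge0 s_ge0 i.
by rewrite addr_ge0//; exact: Kinf_ge0.
Qed.

Lemma Gamma_rho_mono s s' : nonneg s -> nonneg s' -> vle s s' ->
  vle (Gamma_rho Ii gam mu rho s) (Gamma_rho Ii gam mu rho s').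
Proof.
move=> s0 s'0 ss' i; have gg := Gamma_mono s0 s'0 ss' i.
by rewrite lerD//; apply: Kinf_le => //; exact: Gamma_ge0.
Qed.

Lemma Gamma_rho0 : Gamma_rho Ii gam mu rho (fun=> 0) = (fun=> 0).
Proof. by apply/funext => i; rewrite /Gamma_rho Gamma0 (Kinf0 Krho) addr0. Qed.

Lemma Gamma_rho_cvg (T : Type) (G : set_system T) {FG : Filter G}
    (f : T -> I -> R) s i :
  (forall x, nonneg (f x)) -> nonneg s -> (forall j, f x j @[x --> G] --> s j) ->
  Gamma_rho Ii gam mu rho (f x) i @[x --> G] --> Gamma_rho Ii gam mu rho s i.
Proof.
move=> f_ge0 s_ge0 fs; have g := Gamma_cvg (FG := FG) (i := i) f_ge0 s_ge0 fs.
apply: (cvgD g).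
apply: (Kinf_cvg (f := fun x => Gamma Ii gam mu (f x) i) _ _ _ g) => //.
  by move=> x; exact: Gamma_ge0.
exact: Gamma_ge0.
Qed.

End GammaRho.

(** Where the gain is positive, halving [rho] creates a strict gap; where it is 0, the left side is
    0 and [y] is positive. *)
Lemma Gamma_rho_half_lt (rho : R -> R) s i y : Kinf rho -> nonneg s ->
  Gamma_rho Ii gam mu rho s i <= y -> 0 < y ->
  Gamma_rho Ii gam mu (fun r => 1 / 2 * rho r) s i < y.
Proof.
move=> Krho s_ge0; rewrite /Gamma_rho; have := Gamma_ge0 s_ge0 i.
set g := Gamma _ _ _ _ _; rewrite le_eqVlt => /predU1P[<-|g_gt0] gy y_gt0.
  by rewrite (Kinf0 Krho) mulr0 addr0.
by have := Kinf_gt0 Krho g_gt0; lra.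
Qed.

Lemma Kinf_half (rho : R -> R) : Kinf rho -> Kinf (fun r => 1 / 2 * rho r).
Proof. by apply: Kinf_scale; rewrite divr_gt0. Qed.

Lemma path_of_oplus_MBI (rho : R -> R) (i0 : I) : Kinf rho ->
  oplus_MBI (Gamma_rho Ii gam mu rho) ->
  exists sigma : R -> I -> R, path_of_strict_decay Ii gam mu sigma.
Proof.
move=> Krho [phi [Kphi MBI]].
have Kid : Kinf (fun r : R => r).
  by apply: surjective_Kinf => // y y_ge0; exists y.
(* [kappa] is the inverse of [phi] at half the argument, so that [phi (kappa r) = r / 2]. *)
have Kkappa := Kinf_comp (Kinf_Kinv Kphi) (Kinf_half Kid).
set kappa := _ \o _ in Kkappa.
have phi_kappa r : 0 <= r -> phi (kappa r) = 1 / 2 * r.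
  by move=> r_ge0; rewrite /kappa /=; have [] := KinvP (y := 1 / 2 * r) Kphi _;
     rewrite ?mulr_ge0 ?divr_ge0.
(* The lower bound [kappa (nrm s)] makes decaying points comparable to their
   norm in every component, and is small enough to preserve the MBI property. *)
pose F s i := Num.max (Gamma_rho Ii gam mu rho s i) (kappa (nrm s)).
have F_ge0 s : nonneg s -> nonneg (F s).
  by move=> s_ge0 i; rewrite le_max Gamma_rho_ge0.
have F_mono s s' : nonneg s -> nonneg s' -> vle s s' -> vle (F s) (F s').
  move=> s0 s'0 ss' i; rewrite /F ge_max !le_max (Gamma_rho_mono Krho)//=.
  by rewrite (Kinf_le Kkappa) ?nrm_ge0 ?nrm_mono ?orbT.
have F_cvg (G : set_system nat) : ProperFilter G ->
    forall (f : nat -> I -> R) s i, (forall n, nonneg (f n)) -> nonneg s ->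
    (forall j, f n j @[n --> G] --> s j) -> F (f n) i @[n --> G] --> F s i.
  move=> PG f s i f_ge0 s_ge0 fs; apply: cvg_maxr; first exact: Gamma_rho_cvg.
  apply: (Kinf_cvg (f := fun n => nrm (f n)) Kkappa); last exact: nrm_cvg.
    by move=> n; exact: nrm_ge0.
  exact: nrm_ge0.
have F_MBI s b : nonneg s -> nonneg b -> vle s (vmax b (F s)) -> nrm s <= phi (nrm b).
  move=> s_ge0 b_ge0 sb.
  have k_ge0 : 0 <= kappa (nrm s) by exact: Kinf_ge0 (nrm_ge0 s).
  (* The [kappa] term is absorbed into [b]. If it dominates, [nrm s <= nrm s / 2] forces
     [nrm s = 0], so [phi] still serves. *)
  have : nrm s <= phi (Num.max (nrm b) (kappa (nrm s))).
    pose b' := vmax b (fun=> kappa (nrm s)).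
    have b'_ge0 : nonneg b' by move=> i; rewrite /b' /vmax le_max b_ge0.
    apply: le_trans (MBI s b' s_ge0 b'_ge0 _) _.
      move=> i; apply: le_trans (sb i) _.
      by rewrite /b' /vmax /F (maxC (Gamma_rho _ _ _ _ _ _)) maxA.
    apply: (Kinf_le Kphi); first exact: nrm_ge0.
    apply: nonneg_nrm_le => // [|i]; first by rewrite le_max nrm_ge0.
    by rewrite /b' /vmax ge_max !le_max nonneg_le_nrm lexx orbT.
  have [_|_] := leP (kappa (nrm s)) (nrm b) => //.
  rewrite phi_kappa ?nrm_ge0// => h.
  have := Kinf_ge0 Kphi (nrm_ge0 b); have := nrm_ge0 s; lra.
have F_kappa s : nonneg s -> forall i, kappa (nrm s) <= F s i.
  by move=> _ i; rewrite /F le_max lexx orbT.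
have Khalf := Kinf_half Krho.
have [|||t [t_gt0 t_lt Tt t_small t_large]] := @strict_decay_chain R I i0 F phi kappa
  F_ge0 F_mono F_cvg Kphi F_MBI Kkappa F_kappa
  (Gamma_rho Ii gam mu (fun r => 1 / 2 * rho r)).
- exact: Gamma_rho_ge0.
- exact: Gamma_rho_mono.
- move=> s i y s_ge0 Fy; apply: Gamma_rho_half_lt => //.
  by apply: le_trans Fy; rewrite /F le_max lexx.
have Ksigma := chain_path_Kinf t_gt0 t_lt t_small t_large.
exists (chain_path t); split; last split; last split => //.
- exists (fun r => 1 / 2 * rho r); split=> //.
  apply: (chain_path_decay t_gt0 t_lt) => //; first exact: Gamma_rho_mono.
  by rewrite Gamma_rho0.
- have [fmin [fmax [Kmin Kmax fP]]] := Kinf_family_bounds i0 Ksigma.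
  exists fmin, fmax; split=> //; split=> // r _ i; rewrite !mulr1.
  by have /andP[] := fP i r.
- exact: chain_path_inv_bilipschitz.
Qed.

Lemma oplus_MBI_of_path (sigma : R -> I -> R) (i0 : I) :
  path_of_strict_decay Ii gam mu sigma ->
  exists rho : R -> R, Kinf rho /\ oplus_MBI (Gamma_rho Ii gam mu rho).
Proof.
move=> [[rho [Krho decay]] [[fmin [fmax [Kmin [Kmax bounds]]]] [Ksigma _]]].
have Khalf := Kinf_half Krho.
exists (fun r => 1 / 2 * rho r); split=> //.
exists (fmax \o Kinv fmin); split; first exact: Kinf_comp (Kinf_Kinv Kmin).
move=> s b s_ge0 b_ge0 sb.
(* [r k] is the least radius with [s <= sigma (r k)], attained in component [k]. *)
have /choice [r rP] : forall i, exists x, 0 <= x /\ sigma x i = s i.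
  by move=> i; exact: Kinf_surj (Ksigma i) (s_ge0 i).
have [k _ kmax] := @arg_maxP _ _ I i0 xpredT r isT.
have rk_ge0 : 0 <= r k by have [] := rP k.
have sigma_ge0 : nonneg (sigma (r k)).
  by move=> i; exact: Kinf_ge0 (Ksigma i) rk_ge0.
have s_le : vle s (sigma (r k)).
  move=> i; have [ri_ge0 <-] := rP i.
  by apply: (Kinf_le (Ksigma i)) => //; exact: kmax.
have fmin_le : fmin (r k) <= nrm b.
  have [h _] := bounds _ rk_ge0 k; rewrite mulr1 (rP k).2 in h.
  apply: le_trans h _; have := sb k; rewrite /vmax le_max => /orP[h|h].
    exact: le_trans h (nonneg_le_nrm b k).
  (* For [s k > 0] the chain [s k <= Gamma_rho(s) k <= Gamma_rho(sigma (r k)) k < sigma (r k) k = s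
     k], with [rho] halved, is contradictory. *)
  have [s0|] := leP (s k) 0; first exact: le_trans s0 (nrm_ge0 b).
  move=> /(Gamma_rho_half_lt Krho sigma_ge0 (i := k)).
  rewrite -[X in _ -> _ < X](rP k).2 => /(_ _).
  have := decay _ rk_ge0 k; rewrite (rP k).2 => d /(_ d).
  have := Gamma_rho_mono Khalf s_ge0 sigma_ge0 s_le k.
  by move=> h' h''; have := le_lt_trans (le_trans h h') h''; rewrite ltxx.
have [q_ge0 qE] := KinvP Kmin (nrm_ge0 b).
have rk_le : r k <= Kinv fmin (nrm b) by apply: (Kinf_le_rev Kmin) => //; rewrite qE.
apply: nonneg_nrm_le => // [|i]; first exact: (Kinf_ge0 Kmax q_ge0).
apply: le_trans (s_le i) _; have [_] := bounds _ rk_ge0 i; rewrite mulr1.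
by move=> /le_trans; apply; exact: Kinf_le.
Qed.

End GainOperator.

Theorem theorem3p27 (R : realType) (I : finType) (HI : (0 < #|I|)%N)
    (Ii : I -> {set I}) (gam : I -> I -> R -> R) (mu : I -> (I -> R) -> \bar R)
    (Hgain : is_gain_operator Ii gam mu) :
  (exists rho : R -> R, Kinf rho /\ oplus_MBI (Gamma_rho Ii gam mu rho)) <->
  (exists sigma : R -> I -> R, path_of_strict_decay Ii gam mu sigma).
Proof.
have [i0 _] := card_gt0P HI.
split=> [[rho [Krho MBI]]|[sigma path]].
  exact: path_of_oplus_MBI MBI.
exact: oplus_MBI_of_path path.
Qed.
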